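(* Let $F=g+h\circ c$ be the composite function described in the context, with $\mu=L\beta$, and assume $M:=\sup_{x,y\in\operatorname{dom} g}\|x-y\|<\infty$. Let $\rho\ge0$ be a weak convexity constant of $h\circ c$ on $\operatorname{dom} g$ and let $r\ge0$ be a convexity constant of the pair $(h,c)$ on $\operatorname{dom} g$. Fix a real $\tilde\mu>\mu$ and points $x_0,v_0\in\operatorname{dom} g$, and for $k\ge1$ define $$a_k=\tfrac{2}{k+1},\quad y_k=a_kv_{k-1}+(1-a_k)x_{k-1},\quad x_k=S_{1/\tilde\mu}(y_k),\quad v_k=S_{\frac{1}{\tilde\mu a_k},\,a_k}(y_k,v_{k-1}).$$ Let $x^*$ be any point satisfying $F(x^* )\le F(x_k)$ for all iterates $x_k$. Then for every $N\ge1$, $$\min_{j=1,\ldots,N}\|\mathcal{G}_{1/\tilde\mu}(y_j)\|^2\le\frac{24\tilde\mu^2}{\tilde\mu-\mu}\left(\frac{\tilde\mu\|x^*-v_0\|^2}{N(N+1)(2N+1)}+\frac{M^2\big(r+\frac{\rho}{2}(N+3)\big)}{(N+1)(2N+1)}\right).$$ In the case $r=0$, the inequality above holds with the second summand in the parentheses on the right-hand side replaced by zero (even if $M=\infty$), and moreover $$F(x_N)-F(x^* )\le\frac{2\tilde\mu\|x^*-v_0\|^2}{(N+1)^2}.$$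
   Context: Setting: $g\colon\mathbf{R}^d\to\mathbf{R}\cup\{+\infty\}$ is proper, closed and convex; $h\colon\mathbf{R}^m\to\mathbf{R}$ is convex and $L$-Lipschitz continuous; $c\colon\mathbf{R}^d\to\mathbf{R}^m$ is $C^1$-smooth with $\|\nabla c(x)-\nabla c(y)\|_{\rm op}\le\beta\|x-y\|$ for all $x,y$. Set $\mu:=L\beta$ and $F(x):=g(x)+h(c(x))$. Notation: for $t,\alpha>0$, $F_t(z;y):=g(z)+h\big(c(y)+\nabla c(y)(z-y)\big)+\frac{1}{2t}\|z-y\|^2$, $S_t(y):=\operatorname{argmin}_zF_t(z;y)$, $\mathcal{G}_t(x):=t^{-1}(x-S_t(x))$; and $F_\alpha(z;y,v):=g(z)+\frac1\alpha h\big(c(y)+\alpha\nabla c(y)(z-v)\big)$, $F_{t,\alpha}(z;y,v):=F_\alpha(z;y,v)+\frac{1}{2t}\|z-v\|^2$, $S_{t,\alpha}(y,v):=\operatorname{argmin}_zF_{t,\alpha}(z;y,v)$. Weak convexity: $\Phi$ is $\rho$-weakly convex on a set $U$ ($\rho$ is a weak convexity constant of $\Phi$ on $U$) if $\Phi(ax+(1-a)y)\le a\Phi(x)+(1-a)\Phi(y)+\rho a(1-a)\|x-y\|^2$ for all $x,y\in U$, $a\in[0,1]$. Convexity of the pair: $r\ge0$ is a convexity constant of $(h,c)$ on $U$ if $h\big(c(y)+\nabla c(y)(z-y)\big)\le h(c(z))+\frac r2\|z-y\|^2$ for all $z,y\in U$. Such constants exist with $0\le\rho\le r\le\mu$, and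 without loss of generality the paper takes $0\le\rho\le r\le\mu$. *)

(* Defs.v *)
From HB Require Import structures.
From mathcomp Require Import all_boot all_order all_algebra.
From mathcomp Require Import all_classical all_reals all_analysis.

Set Implicit Arguments.
Unset Strict Implicit.
Unset Printing Implicit Defensive.

Import Order.TTheory GRing.Theory Num.Theory.
Import numFieldNormedType.Exports.

Local Open Scope classical_set_scope.
Local Open Scope ring_scope.

(* The points of R^n are row vectors.  Their library norm `|x| is the sup norm;
   the norm meant throughout is the Euclidean one. *)
Definition enorm (R : realType) n (x : 'rV[R]_n) : R :=
  Num.sqrt (\sum_(i < n) x ord0 i ^+ 2).

(* A matrix acts on row vectors from the right.  In particular jacobian c y is
   the transpose of the usual Jacobian matrix, and the vector denoted by
   nabla c(y) w on paper is w *m jacobian c y = 'd c y w. *)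
Definition opnorm (R : realType) d m (A : 'M[R]_(d, m)) : R :=
  sup [set enorm (u *m A) | u in [set u : 'rV[R]_d | enorm u <= 1]].

Definition C1_smooth (R : realType) d m (c : 'rV[R]_d -> 'rV[R]_m) : Prop :=
  (forall x, differentiable c x) /\ continuous (fun x => jacobian c x).

Definition lipschitz_jacobian (R : realType) d m (beta : R)
    (c : 'rV[R]_d -> 'rV[R]_m) : Prop :=
  forall x y, opnorm (jacobian c x - jacobian c y) <= beta * enorm (x - y).

Definition elipschitz (R : realType) m (L : R) (h : 'rV[R]_m -> R) : Prop :=
  forall u w, `|h u - h w| <= L * enorm (u - w).

Section extended_valued.
Context {R : realType} {d : nat}.
Implicit Types g : 'rV[R]_d -> \bar R.
Local Open Scope ereal_scope.

Definition edom g : set 'rV[R]_d := [set x | g x < +oo].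

Definition eproper g : Prop := (forall x, g x != -oo) /\ edom g !=set0.

Definition eclosed g : Prop :=
  closed [set p : 'rV[R]_d * R | g p.1 <= p.2%:E].

(* At a = 0 and a = 1 the library convention 0 * +oo = 0 makes the inequality
   trivial, as it should be. *)
Definition econvex g : Prop :=
  forall (x y : 'rV[R]_d) (a : R), (0 <= a <= 1)%R ->
    g (a *: x + (1 - a) *: y)%R <= a%:E * g x + (1 - a)%:E * g y.

Definition edom_diam g : \bar R :=
  ereal_sup [set (enorm (x - y)%R)%:E | x in edom g & y in edom g].

Definition argmin g : set 'rV[R]_d := [set z | forall w, g z <= g w].

(* The minimizer, for functions that have a unique one; 0 if there is none. *)
Definition argmin_pt g : 'rV[R]_d := xget 0%R (argmin g).

End extended_valued.

(* Note the factor rho instead of the also common rho / 2. *)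
Definition weakly_convex_on (R : realType) d (rho : R) (U : set 'rV[R]_d)
    (Phi : 'rV[R]_d -> R) : Prop :=
  forall x y, U x -> U y -> forall a : R, 0 <= a <= 1 ->
    Phi (a *: x + (1 - a) *: y) <=
      a * Phi x + (1 - a) * Phi y + rho * a * (1 - a) * enorm (x - y) ^+ 2.

Definition pair_convex_on (R : realType) d m (r : R) (U : set 'rV[R]_d)
    (h : 'rV[R]_m -> R) (c : 'rV[R]_d -> 'rV[R]_m) : Prop :=
  forall z y, U z -> U y ->
    h (c y + (z - y) *m jacobian c y) <= h (c z) + r / 2 * enorm (z - y) ^+ 2.

Section composite.
Context {R : realType} {d m : nat}.
Variables (g : 'rV[R]_d -> \bar R) (h : 'rV[R]_m -> R)
  (c : 'rV[R]_d -> 'rV[R]_m).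
Implicit Types (t alpha : R) (x y z v : 'rV[R]_d).

Definition Fobj x : \bar R := (g x + (h (c x))%:E)%E.

Definition prox_model t y z : \bar R :=
  (g z + (h (c y + (z - y) *m jacobian c y)
          + (2 * t)^-1 * enorm (z - y) ^+ 2)%R%:E)%E.

Definition prox_step t y : 'rV[R]_d := argmin_pt (prox_model t y).

Definition prox_grad t x : 'rV[R]_d := t^-1 *: (x - prox_step t x).

Definition acc_model alpha y v z : \bar R :=
  (g z + (alpha^-1 * h (c y + alpha *: ((z - v) *m jacobian c y)))%R%:E)%E.

Definition acc_prox_model t alpha y v z : \bar R :=
  (acc_model alpha y v z + ((2 * t)^-1 * enorm (z - v) ^+ 2)%R%:E)%E.

Definition acc_step t alpha y v : 'rV[R]_d :=
  argmin_pt (acc_prox_model t alpha y v).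

End composite.

(* min (f 1, ..., f N), for N >= 1. *)
Definition min_from1 (R : realType) (N : nat) (f : nat -> R) : R :=
  \big[Num.min/f 1%N]_(2 <= j < N.+1) f j.

(* Main.v *)
Require Import Defs.
From HB Require Import structures.
From mathcomp Require Import all_boot all_order all_algebra.
From mathcomp Require Import all_classical all_reals all_analysis.
From mathcomp Require Import finmap ring lra.
Set Implicit Arguments.
Unset Strict Implicit.
Unset Printing Implicit Defensive.

Import Order.TTheory GRing.Theory Num.Theory.
Import numFieldNormedType.Exports.

Local Open Scope classical_set_scope.
Local Open Scope ring_scope.

(** The proof is a potential-function argument for an accelerated scheme.

    Both subproblems minimize a strongly convex, closed, proper function:
    [regularized_argmin] shows that the minimum is attained and that the values
    grow quadratically away from it.  Existence uses compactness of balls and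
    the coercivity hidden in strong convexity
    ([strongly_econvex_has_argmin]).

    One iteration is then analysed by chaining inequalities
    ([accelerated_step]).  The true objective at [x_k] exceeds its prox-linear
    model by at most [mu / 2 * |x_k - y_k| ^ 2]; since the model is regularized
    with the larger constant [tmu], a multiple [(tmu - mu) / 2] of
    [|x_k - y_k| ^ 2] is gained.  Minimality of [x_k] is tested at
    [a_k *: v_k + (1 - a_k) *: x_(k-1)], minimality of [v_k] at [xs], and the
    two constants [r] and [rho] convert the linearized value at
    [a_k *: xs + (1 - a_k) *: x_(k-1)] into the values of the objective at [xs]
    and at [x_(k-1)].  The outcome bounds the gap [F x_k - F xs] by
    [1 - a_k] times the previous gap, plus a telescoping difference of squared
    distances from [xs] to the [v_k], plus error terms in [r] and [rho], minus
    the gain.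

    Dividing by [a_k ^ 2] and summing ([accelerated_telescope]) makes the gap
    and the distances telescope.  As the squared prox gradient at [y_k] is
    [tmu ^ 2 * |x_k - y_k| ^ 2], the accumulated gain is at least a constant
    times its minimum times [\sum_k (k + 1) ^ 2 / 4], which is of cubic order;
    dropping the gap instead of the gain, or conversely, gives the two rates.
    If [r = 0] the composite is convex on the domain
    ([pair_convex_on0_convex]), so all error terms vanish and the diameter of
    the domain does not enter. *)

(** * Euclidean geometry of row vectors *)

Section euclidean.
Context {R : realType}.

Definition edot n (u w : 'rV[R]_n) : R := \sum_(i < n) u ord0 i * w ord0 i.

Lemma edotC n (u w : 'rV[R]_n) : edot u w = edot w u.
Proof. by apply: eq_bigr => i _; rewrite mulrC. Qed.

Lemma edotDl n (u v w : 'rV[R]_n) : edot (u + v) w = edot u w + edot v w.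
Proof. by rewrite -big_split; apply: eq_bigr => i _; rewrite !mxE mulrDl. Qed.

Lemma edotZl n a (u w : 'rV[R]_n) : edot (a *: u) w = a * edot u w.
Proof. by rewrite mulr_sumr; apply: eq_bigr => i _; rewrite !mxE mulrA. Qed.

Lemma edotNl n (u w : 'rV[R]_n) : edot (- u) w = - edot u w.
Proof. by rewrite -scaleN1r edotZl mulN1r. Qed.

Lemma edotDr n (u v w : 'rV[R]_n) : edot w (u + v) = edot w u + edot w v.
Proof. by rewrite !(edotC w) edotDl. Qed.

Lemma edotZr n a (u w : 'rV[R]_n) : edot u (a *: w) = a * edot u w.
Proof. by rewrite !(edotC u) edotZl. Qed.

Lemma edotNr n (u w : 'rV[R]_n) : edot u (- w) = - edot u w.
Proof. by rewrite !(edotC u) edotNl. Qed.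

Definition edotE := (edotDl, edotDr, edotNl, edotNr, edotZl, edotZr).

Lemma enorm_ge0 n (u : 'rV[R]_n) : 0 <= enorm u.
Proof. exact: sqrtr_ge0. Qed.

Lemma enorm_sqr n (u : 'rV[R]_n) : enorm u ^+ 2 = edot u u.
Proof.
rewrite sqr_sqrtr; first by apply: eq_bigr => i _; rewrite expr2.
by apply: sumr_ge0 => i _; exact: sqr_ge0.
Qed.

Lemma enormZ n a (u : 'rV[R]_n) : enorm (a *: u) = `|a| * enorm u.
Proof.
apply/eqP; rewrite -(@eqrXn2 _ 2%N) ?mulr_ge0 ?enorm_ge0//.
by rewrite exprMn !enorm_sqr !edotE real_normK ?num_real// expr2 mulrA.
Qed.

Lemma enormN n (u : 'rV[R]_n) : enorm (- u) = enorm u.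
Proof. by rewrite -scaleN1r enormZ normrN1 mul1r. Qed.

Lemma enorm_distC n (u w : 'rV[R]_n) : enorm (u - w) = enorm (w - u).
Proof. by rewrite -enormN opprB. Qed.

Lemma enorm0 n : enorm (0 : 'rV[R]_n) = 0.
Proof. by rewrite -(scale0r 0) enormZ normr0 mul0r. Qed.

Lemma ler_coord_enorm n (u : 'rV[R]_n) i : `|u ord0 i| <= enorm u.
Proof.
rewrite -(@ler_pXn2r _ 2%N) ?nnegrE ?enorm_ge0// enorm_sqr.
rewrite real_normK ?num_real// /edot (bigD1 i)//= -expr2 lerDl.
by apply: sumr_ge0 => j _; rewrite -expr2 sqr_ge0.
Qed.

Lemma enorm_eq0 n (u : 'rV[R]_n) : (enorm u == 0) = (u == 0).
Proof.
apply/eqP/eqP => [u0|->]; last exact: enorm0.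
apply/rowP => i; rewrite mxE; apply/eqP; rewrite -normr_le0 -u0.
exact: ler_coord_enorm.
Qed.

(** Cauchy-Schwarz: expand the square of [enorm w *: u - enorm u *: w]. *)
Lemma edot_le_enorm n (u w : 'rV[R]_n) : edot u w <= enorm u * enorm w.
Proof.
have [->|u0] := eqVneq u 0.
  by rewrite enorm0 mul0r -(scale0r 0) edotZl mul0r.
have [->|w0] := eqVneq w 0.
  by rewrite enorm0 mulr0 -(scale0r 0) edotZr mul0r.
have pu : 0 < enorm u by rewrite lt_def enorm_eq0 u0 enorm_ge0.
have pw : 0 < enorm w by rewrite lt_def enorm_eq0 w0 enorm_ge0.
have := sqr_ge0 (enorm (enorm w *: u - enorm u *: w)).
rewrite enorm_sqr !edotE -!enorm_sqr (edotC w u) => H.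
rewrite -(ler_pM2l (mulr_gt0 pu pw)); nra.
Qed.

Lemma ler_enormD n (u w : 'rV[R]_n) : enorm (u + w) <= enorm u + enorm w.
Proof.
rewrite -(@ler_pXn2r _ 2%N) ?nnegrE ?addr_ge0 ?enorm_ge0//.
rewrite sqrrD !enorm_sqr !edotE (edotC w u).
by have := edot_le_enorm u w; rewrite mulr2n; lra.
Qed.

Lemma enorm_sum n I (s : seq I) (f : I -> 'rV[R]_n) :
  enorm (\sum_(i <- s) f i) <= \sum_(i <- s) enorm (f i).
Proof.
elim/big_rec2: _ => [|i y1 y2 _ h]; first by rewrite enorm0.
by rewrite (le_trans (ler_enormD _ _))// lerD2l.
Qed.

(** The squared norm satisfies the inequality defining strong convexity with
    equality; this is the source of every quadratic gain below. *)
Lemma enorm_sqr_conv n a (u w : 'rV[R]_n) :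
  enorm (a *: u + (1 - a) *: w) ^+ 2 =
  a * enorm u ^+ 2 + (1 - a) * enorm w ^+ 2 - a * (1 - a) * enorm (u - w) ^+ 2.
Proof. rewrite !enorm_sqr !edotE (edotC w u); ring. Qed.

Lemma ler_norm_enorm n (u : 'rV[R]_n) : `|u| <= enorm u.
Proof.
rewrite {1}/Num.norm/= mx_normrE; apply: bigmax_le; first exact: enorm_ge0.
by move=> [i j] _; rewrite ord1 ler_coord_enorm.
Qed.

Lemma enorm_continuous n : continuous (@enorm R n).
Proof.
have sqr_continuous : continuous (fun u : 'rV[R]_n => \sum_i u ord0 i ^+ 2).
  apply: (continuous_big add_continuous) => i _ u.
  apply: (@continuous_comp _ _ _ (fun w : 'rV[R]_n => w ord0 i)
    (fun t : R => t ^+ 2)); first exact: coord_continuous.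
  exact: exprn_continuous.
move=> u; apply: continuous_comp; first exact: sqr_continuous.
exact: sqrt_continuous.
Qed.

Lemma enorm_sub_continuous n (z : 'rV[R]_n) :
  continuous (fun u : 'rV[R]_n => enorm (u - z)).
Proof.
move=> u; apply: (@continuous_comp _ _ _ (fun u : 'rV[R]_n => u - z)).
  by apply: continuousB; [exact: cvg_id|exact: cst_continuous].
exact: enorm_continuous.
Qed.

Lemma enorm_ball_compact n (z : 'rV[R]_n) (b : R) :
  compact [set u : 'rV[R]_n | enorm (u - z) <= b].
Proof.
apply: bounded_closed_compact.
  exists (enorm z + b); split; first exact: num_real.
  move=> M lM u /= ub; rewrite (le_trans (ler_norm_enorm u))// ltW//.
  rewrite (le_lt_trans _ lM)// -(subrKC z u).
  by rewrite (le_trans (ler_enormD _ _))// lerD2l.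
apply: (@preimage_closed _ _ (fun u : 'rV[R]_n => enorm (u - z))
  [set t | t <= b]); last exact: closed_le.
by move=> u _; exact: enorm_sub_continuous.
Qed.

End euclidean.

(** * The linearization error of a map with Lipschitz Jacobian *)

Section linearization.
Context {R : realType}.

Lemma enorm_mulmx_bound d m (A : 'M[R]_(d, m)) (u : 'rV[R]_d) :
  enorm (u *m A) <= enorm u * \sum_i enorm (row i A).
Proof.
rewrite mulmx_sum_row (le_trans (enorm_sum _ _))// mulr_sumr.
by apply: ler_sum => i _; rewrite enormZ ler_wpM2r ?enorm_ge0 ?ler_coord_enorm.
Qed.

Lemma enorm_mulmx_opnorm d m (A : 'M[R]_(d, m)) (u : 'rV[R]_d) :
  enorm (u *m A) <= opnorm A * enorm u.
Proof.
have [->|u0] := eqVneq u 0; first by rewrite mul0mx !enorm0 mulr0.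
have pu : 0 < enorm u by rewrite lt_def enorm_eq0 u0 enorm_ge0.
rewrite -ler_pdivrMr// mulrC -[X in X * _]gtr0_norm ?invr_gt0// -enormZ scalemxAl.
apply: ub_le_sup.
  exists (\sum_i enorm (row i A)) => _ [w w1 <-].
  rewrite (le_trans (enorm_mulmx_bound A w))// ler_piMl//.
  by apply: sumr_ge0 => i _; exact: enorm_ge0.
exists ((enorm u)^-1 *: u) => //=.
by rewrite enormZ gtr0_norm ?invr_gt0// mulVf ?gt_eqF.
Qed.

(** Both difference quotients are the same function of the increment. *)
Lemma is_derive_along_line (V W : normedModType R) (f : V -> W) (y w : V)
    (s : R) (df : W) :
  is_derive (y + s *: w) w f df -> is_derive s 1 (fun t => f (y + t *: w)) df.
Proof.
case=> fdrv fE.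
have dE : (fun h : R => h^-1 *: (((fun t => f (y + t *: w)) \o shift s)
              (h *: (1 : R)) - f (y + s *: w))) =
          (fun h : R => h^-1 *: ((f \o shift (y + s *: w)) (h *: w)
              - f (y + s *: w))).
  apply/funext => h /=; congr (_ *: (f _ - _)).
  by rewrite [h *: (1 : R)]mulr1 scalerDl addrCA.
by apply: DeriveDef; [rewrite /derivable dE|rewrite /derive dE].
Qed.

Lemma is_derive_edot (V : normedModType R) n (e : 'rV[R]_n) (f : V -> 'rV[R]_n)
    (x v : V) (df : 'rV[R]_n) :
  is_derive x v f df -> is_derive x v (fun y => edot e (f y)) (edot e df).
Proof.
move=> [fdrv <-].
have -> : (fun y => edot e (f y)) =
          \sum_(i < n) (fun y => e ord0 i *: (f y ord0 i : R)).
  by apply/funext => y; rewrite fct_sumE.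
apply: is_derive_sum => i; apply: is_deriveZ.
rewrite derive_mx// mxE; apply: DeriveDef => //.
by move/derivable_mxP: fdrv; exact.
Qed.

(** Paired with a fixed vector [e], the error along the segment from [y] to [z]
    has derivative at most [enorm e * beta * s * enorm (z - y) ^+ 2] at time
    [s]; a scalar mean value argument then bounds the pairing, and choosing for
    [e] the error itself bounds its norm. *)
Lemma linearization_error d m (beta : R) (c : 'rV[R]_d -> 'rV[R]_m) y z :
  0 <= beta -> (forall x, differentiable c x) -> lipschitz_jacobian beta c ->
  enorm (c z - (c y + (z - y) *m jacobian c y)) <=
    beta / 2 * enorm (z - y) ^+ 2.
Proof.
move=> beta0 cdiff clip; rewrite opprD addrA; set w := z - y.
set e := c z - c y - _; have eE : e = c z - c y - w *m jacobian c y by [].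
clearbody e.
pose K := enorm e * beta * enorm w ^+ 2.
pose D := edot e (w *m jacobian c y).
pose psi s := edot e (c (y + s *: w)) - (D * s + K / 2 * s ^+ 2).
pose dpsi s := edot e (w *m jacobian c (y + s *: w)) - (D + K * s).
have dpsiP s : is_derive s (1 : R) psi (dpsi s).
  have h1 : is_derive s (1 : R) (fun s => edot e (c (y + s *: w)))
      (edot e (w *m jacobian c (y + s *: w))).
    apply: is_derive_edot; apply: is_derive_along_line.
    apply: DeriveDef; first exact: diff_derivable.
    exact: deriveEjacobian.
  have h2 : is_derive s (1 : R) (fun s => D * s + K / 2 * s ^+ 2) (D + K * s).
    have -> : (fun s => D * s + K / 2 * s ^+ 2) =
        D \*: (@id R) + (K / 2) \*: ((@id R) ^+ 2).
      by apply/funext => t; rewrite !fctE.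
    apply: is_derive_eq; rewrite expr1 /GRing.scale/= !mulr1.
    by congr (_ + _); field.
  exact: is_deriveB.
have psi_cont : {within `[0, 1], continuous psi}.
  by apply: derivable_within_continuous => s _; case: (dpsiP s).
have [s] := MVT ltr01 (fun x _ => dpsiP x) psi_cont.
rewrite in_itv/= => /andP[s0 s1].
rewrite subr0 mulr1 => psiE.
have : dpsi s <= 0.
  rewrite /dpsi/D/K subr_le0 -lerBlDl -edotNr -edotDr -mulmxBr.
  rewrite (le_trans (edot_le_enorm _ _))//.
  rewrite -!mulrA ler_wpM2l ?enorm_ge0//.
  rewrite (le_trans (enorm_mulmx_opnorm _ _))//.
  have := clip (y + s *: w) y.
  have -> : enorm (y + s *: w - y) = s * enorm w.
    by rewrite addrAC subrr add0r enormZ gtr0_norm.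
  move/(ler_wpM2r (enorm_ge0 w))/le_trans; apply.
  by rewrite -!mulrA (mulrC s) -mulrA.
rewrite -psiE /psi scale1r scale0r addr0 subr_le0 mulr0 expr0n/= !mulr0 addr0.
rewrite expr1n !mulr1 subr0 (_ : y + w = z); last by rewrite /w subrKC.
move=> H; have : edot e e <= enorm e * (beta / 2 * enorm w ^+ 2).
  rewrite [X in edot e X]eE !edotE -/D; apply: (@le_trans _ _ (K / 2)); first lra.
  by rewrite /K; lra.
rewrite -enorm_sqr expr2.
have [e0 _|e0] := eqVneq (enorm e) 0.
  by rewrite e0 mulr_ge0 ?sqr_ge0// divr_ge0.
by rewrite ler_pM2l// lt_def e0 enorm_ge0.
Qed.

End linearization.

(** * Minimizers of strongly convex functions *)

Section minimizers.
Context {R : realType} {d : nat}.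
Implicit Types (f g : 'rV[R]_d -> \bar R) (u w x y z : 'rV[R]_d).

Lemma sublevel_closed f (b : R) : eclosed f -> closed [set x | (f x <= b%:E)%E].
Proof.
move=> fcl; apply: (@preimage_closed _ _ (fun x => (x, b)) _ _ fcl) => x _.
apply: (@cvg_pair _ _ _ (nbhs x) (nbhs x) (nbhs b)).
  exact: cvg_id.
exact: cvg_cst.
Qed.

(** If no point of the compact set were a minimizer, the open sets
    [f w < f x], with [w] in the compact set, would cover it; the [w] of
    smallest value in a finite subcover lies in none of its members. *)
Lemma eclosed_compact_min f (K : set 'rV[R]_d) :
  eclosed f -> (forall x, f x != -oo%E) -> compact K -> K !=set0 ->
  exists2 z, K z & forall w, K w -> (f z <= f w)%E.
Proof.
move=> fcl fNy; rewrite compact_cover => Kc [x0 Kx0]; apply: contrapT => nomin.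
pose U w := [set x | (f w < f x)%E].
have Uopen w : K w -> open (U w).
  move=> _; rewrite /U; case fw : (f w) (fNy w) => [b| |]// _; last first.
    rewrite (_ : mkset _ = set0); first exact: open0.
    by rewrite -subset0 => x /=; rewrite ltNge leey.
  have := @sublevel_closed f b fcl; rewrite -openC; congr open.
  by apply/seteqP; split => x /=; rewrite ltNge => /negP.
have Kcover : K `<=` cover K U.
  move=> x Kx; apply: contrapT => xU; apply: nomin; exists x => // w Kw.
  by rewrite leNgt; apply/negP => fwx; apply: xU; exists w.
have [D DK Dcover] := Kc _ K U Uopen Kcover.
have [w0 Dw0 _] := Dcover _ Kx0.
pose w := [arg min_(w < [` Dw0]%fset) f (val w)]%O.
have [v /= Dv] := Dcover (val w) (set_mem (DK _ (valP w))).
rewrite /U/= ltNge => /negP; apply.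
by rewrite /w; case: arg_minP => // i _ /(_ [` Dv]%fset isT).
Qed.

Definition strongly_econvex (s : R) f := forall x y a, 0 <= a <= 1 ->
  (f (a *: x + (1 - a) *: y)%R
     + (s / 2 * (a * (1 - a) * enorm (x - y) ^+ 2))%R%:E
   <= a%:E * f x + (1 - a)%:E * f y)%E.

(** Compare the values at [z], at a point [w] outside the unit ball about [z],
    and at the point where the segment between them leaves that ball: as [f] is
    bounded below on the unit ball, strong convexity makes [f w] larger than
    [f z] as soon as [w] is far away, so the minimum over a large compact ball
    is global. *)
Lemma strongly_econvex_has_argmin (s : R) f : 0 < s ->
  eproper f -> eclosed f -> strongly_econvex s f -> argmin f !=set0.
Proof.
move=> s0 [fNy [z fz]] fcl fsc.
have minball b : 0 <= b -> exists2 x, (f x <= f z)%E &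
    forall w, enorm (w - z) <= b -> (f x <= f w)%E.
  move=> b0; have zb : enorm (z - z) <= b by rewrite subrr enorm0.
  have [|x xb xmin] := eclosed_compact_min fcl fNy (@enorm_ball_compact _ _ z b).
    by exists z.
  by exists x; [exact: xmin|].
have [x1 fx1 x1min] := minball 1 ler01.
have fin w : (f w < +oo)%E -> exists b, f w = b%:E.
  by move=> fw; exists (fine (f w)); rewrite fineK// fin_numE fNy lt_eqF.
have [F0 F0E] := fin _ fz.
have [m1 m1E] := fin _ (le_lt_trans fx1 fz).
have m1F0 : m1 <= F0 by rewrite -lee_fin -m1E -F0E.
pose b0 := 1 + 2 * (F0 - m1) / s.
have b01 : 1 <= b0 by rewrite lerDl divr_ge0 ?mulr_ge0 ?subr_ge0// ltW.
have [x2 fx2 x2min] := minball b0 (le_trans ler01 b01).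
exists x2 => w.
have [/x2min//|bw] := leP (enorm (w - z)) b0.
rewrite (le_trans fx2)// leNgt; apply/negP => fwz.
have [W WE] := fin _ (lt_trans fwz fz).
set b := enorm (w - z) in bw.
have b1 : 1 < b := le_lt_trans b01 bw.
have bp : 0 < b := lt_trans ltr01 b1.
have a01 : 0 <= b^-1 <= 1 by rewrite invr_ge0 ltW//= invf_le1 ?ltW.
have := fsc w z _ a01; rewrite -/b WE F0E.
have : (f x1 <= f (b^-1 *: w + (1 - b^-1) *: z)%R)%E.
  apply: x1min; rewrite (_ : _ - z = b^-1 *: (w - z)).
    by rewrite enormZ gtr0_norm ?invr_gt0// mulVf ?gt_eqF.
  by rewrite scalerBl scale1r scalerBr addrCA addrAC subrr add0r.
rewrite m1E => h1 h2.
have {h1 h2} : (m1%:E + (s / 2 * (b^-1 * (1 - b^-1) * b ^+ 2))%R%:E <=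
    (b^-1)%:E * W%:E + (1 - b^-1)%:E * F0%:E)%E.
  by apply: le_trans h2; rewrite leeD2r.
rewrite -!EFinM -!EFinD lee_fin.
move: fwz; rewrite WE F0E lte_fin => WF0.
rewrite -(ler_pM2l bp) => H.
have {}H : b * m1 + s / 2 * (b - 1) * b <= W + (b - 1) * F0.
  suff <- : b * (b^-1 * W + (1 - b^-1) * F0) = W + (b - 1) * F0.
    apply: le_trans H; rewrite le_eqVlt; apply/orP; left; apply/eqP.
    by field; rewrite gt_eqF.
  by field; rewrite gt_eqF.
have : 2 * (F0 - m1) < s * (b - 1).
  by rewrite -ltr_pdivrMl// mulrC ltrBrDl.
nra.
Qed.

(** Strong convexity between the minimizer and [w], at a point close to the
    minimizer. *)
Lemma strongly_econvex_growth (s : R) f z w : 0 < s -> eproper f ->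
  strongly_econvex s f -> argmin f z ->
  (f z + (s / 2 * enorm (w - z) ^+ 2)%R%:E <= f w)%E.
Proof.
move=> s0 [fNy [x0 fx0]] fsc zmin.
have fzy : (f z < +oo)%E := le_lt_trans (zmin _) fx0.
case fw : (f w) (fNy w) => [W| |]// _; last by rewrite leey.
case fz : (f z) fzy (fNy z) => [m| |]// _ _.
rewrite -EFinD lee_fin; set K := s / 2 * _.
have K0 : 0 <= K by rewrite mulr_ge0 ?sqr_ge0 ?divr_ge0 ?ltW.
rewrite leNgt; apply/negP => WK.
have mW : m <= W by rewrite -lee_fin -fw -fz; exact: zmin.
have Kp : 0 < K by lra.
pose a := (K - (W - m)) / (2 * K).
have a0 : 0 < a by rewrite divr_gt0//; lra.
have a1 : a <= 1 by rewrite ler_pdivrMr//; lra.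
have a01 : 0 <= a <= 1 by rewrite ltW.
have := fsc w z _ a01; rewrite fw fz => h2.
have : (m%:E + (s / 2 * (a * (1 - a) * enorm (w - z) ^+ 2))%R%:E <=
    a%:E * W%:E + (1 - a)%:E * m%:E)%E.
  by apply: le_trans h2; rewrite leeD2r// -fz; exact: zmin.
rewrite -!EFinM -!EFinD lee_fin.
have -> : s / 2 * (a * (1 - a) * enorm (w - z) ^+ 2) = a * ((1 - a) * K).
  by rewrite /K; ring.
move=> H; have : (1 - a) * K <= W - m by rewrite -(ler_pM2l a0); lra.
have -> : (1 - a) * K = (K + (W - m)) / 2.
  by rewrite /a; field; rewrite gt_eqF.
lra.
Qed.

Lemma eclosedD_continuous g (q : 'rV[R]_d -> R) :
  eclosed g -> continuous q -> eclosed (fun x => g x + (q x)%:E)%E.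
Proof.
move=> gcl qc.
rewrite /eclosed (_ : mkset _ = (fun p : 'rV[R]_d * R => (p.1, p.2 - q p.1))
   @^-1` [set p | (g p.1 <= (p.2)%:E)%E]).
  apply: (@preimage_closed _ _ _ _ _ gcl) => p _.
  apply: (@cvg_pair _ _ _ (nbhs p) (nbhs p.1) (nbhs (p.2 - q p.1))).
    exact: cvg_fst.
  apply: continuousB; first exact: cvg_snd.
  by apply: continuous_comp; [exact: cvg_fst|exact: qc].
by apply/seteqP; split => p /=; rewrite EFinB leeBrDr.
Qed.

Lemma strongly_econvexD (s : R) g (q : 'rV[R]_d -> R) :
  (forall x, g x != -oo%E) -> econvex g ->
  (forall x y a, 0 <= a <= 1 ->
    q (a *: x + (1 - a) *: y) + s / 2 * (a * (1 - a) * enorm (x - y) ^+ 2) <=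
    a * q x + (1 - a) * q y) ->
  strongly_econvex s (fun x => g x + (q x)%:E)%E.
Proof.
move=> gNy gcvx qsc x y a a01; rewrite -addeA -EFinD.
rewrite !muleDr ?fin_num_adde_defl// addeACA -!EFinM -EFinD.
by apply: leeD; [exact: gcvx|rewrite lee_fin; exact: qsc].
Qed.

Lemma elipschitz_continuous (l : R) (f : 'rV[R]_d -> R) :
  elipschitz l f -> continuous f.
Proof.
move=> flip x; apply/(@cvgrPdist_le _ _ _ (nbhs x)) => e e0.
have : {for x, continuous (fun y : 'rV[R]_d => l * enorm (y - x))}.
  by apply: continuousM; [exact: cst_continuous|exact: enorm_sub_continuous].
rewrite /prop_for /continuous_at.
rewrite subrr enorm0 mulr0 => /(@cvgrPdist_le _ _ _ (nbhs x))/(_ e e0).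
apply: filterS => y.
rewrite sub0r normrN => h; rewrite (le_trans (flip _ _))// enorm_distC.
by rewrite (le_trans (ler_norm _)).
Qed.

End minimizers.

(** * The two subproblems and the one-step inequality *)

Section models.
Context {R : realType} {d m : nat}.
Variables (g : 'rV[R]_d -> \bar R) (h : 'rV[R]_m -> R) (L : R).
Hypotheses (g_proper : eproper g) (g_closed : eclosed g) (g_convex : econvex g)
  (h_convex : convex_function [set: 'rV[R]_m] h)
  (L_ge0 : 0 <= L) (h_lip : elipschitz L h).
Implicit Types (x y z v w : 'rV[R]_d).

Let G x : R := fine (g x).

Lemma fine_edom x : edom g x -> g x = (fine (g x))%:E.
Proof.
by move=> gx; rewrite fineK// fin_numE (proj1 g_proper) lt_eqF.
Qed.

Lemma edom_conv x y a : 0 <= a <= 1 -> edom g x -> edom g y ->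
  edom g (a *: x + (1 - a) *: y).
Proof.
move=> a01 gx gy; rewrite /edom/= (le_lt_trans (g_convex _ _ a01))//.
by rewrite (fine_edom gx) (fine_edom gy) -!EFinM -EFinD ltry.
Qed.

Lemma fine_convex x y a : 0 <= a <= 1 -> edom g x -> edom g y ->
  G (a *: x + (1 - a) *: y) <= a * G x + (1 - a) * G y.
Proof.
move=> a01 gx gy; rewrite -lee_fin EFinD !EFinM -!fine_edom//.
  exact: g_convex.
exact: edom_conv.
Qed.

Lemma convex_functionE (u w : 'rV[R]_m) a : 0 <= a <= 1 ->
  h (a *: u + (1 - a) *: w) <= a * h u + (1 - a) * h w.
Proof.
move=> /andP[a0 a1].
by have := @h_convex (Itv01 a0 a1) u w (in_setT _) (in_setT _).
Qed.

(** Both subproblems minimize [g] plus a convex Lipschitz function of an affine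
    map plus a squared distance, hence a strongly convex function. *)
Lemma regularized_argmin (k s : R) (p : 'rV[R]_m) (A : 'M[R]_(d, m)) v
    (f : 'rV[R]_d -> \bar R) :
  0 <= k -> 0 < s ->
  (forall z, f z =
    (g z + (k * h (p + (z - v) *m A) + s / 2 * enorm (z - v) ^+ 2)%R%:E)%E) ->
  edom g (argmin_pt f) /\
  forall w, edom g w ->
    G (argmin_pt f) + (k * h (p + (argmin_pt f - v) *m A)
      + s / 2 * enorm (argmin_pt f - v) ^+ 2)
      + s / 2 * enorm (w - argmin_pt f) ^+ 2
    <= G w + (k * h (p + (w - v) *m A) + s / 2 * enorm (w - v) ^+ 2).
Proof.
move=> k0 s0 fE.
pose q z := k * h (p + (z - v) *m A) + s / 2 * enorm (z - v) ^+ 2.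
have {}fE : f = (fun z => g z + (q z)%:E)%E by apply/funext.
have lin_lip : elipschitz (L * opnorm A) (fun z => h (p + (z - v) *m A)).
  move=> z w; rewrite (le_trans (h_lip _ _))// -mulrA ler_wpM2l//.
  have -> : p + (z - v) *m A - (p + (w - v) *m A) = (z - w) *m A.
    by rewrite opprD addrACA subrr add0r -mulmxBl opprB addrA subrK.
  exact: enorm_mulmx_opnorm.
have qcont : continuous q.
  move=> z.
  apply: (@continuousD _ _ _ (fun z => k * h (p + (z - v) *m A))
    (fun z => s / 2 * enorm (z - v) ^+ 2)).
    apply: continuousM; first exact: cst_continuous.
    exact: elipschitz_continuous lin_lip z.
  apply: continuousM; first exact: cst_continuous.
  apply: (@continuous_comp _ _ _ (fun z => enorm (z - v)) (fun t : R => t ^+ 2)).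
    exact: enorm_sub_continuous.
  exact: exprn_continuous.
have combE a x y : a *: x + (1 - a) *: y - v = a *: (x - v) + (1 - a) *: (y - v).
  by rewrite !scalerBr addrACA -opprD -scalerDl addrCA subrr addr0 scale1r.
have qsc x y a : 0 <= a <= 1 ->
    q (a *: x + (1 - a) *: y) + s / 2 * (a * (1 - a) * enorm (x - y) ^+ 2) <=
    a * q x + (1 - a) * q y.
  move=> a01; rewrite /q combE enorm_sqr_conv.
  have -> : x - v - (y - v) = x - y by rewrite opprB addrA subrK.
  have -> : p + (a *: (x - v) + (1 - a) *: (y - v)) *m A =
      a *: (p + (x - v) *m A) + (1 - a) *: (p + (y - v) *m A).
    rewrite mulmxDl -!scalemxAl !scalerDr addrACA -scalerDl.
    by rewrite (addrC a) subrK scale1r.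
  have := convex_functionE (p + (x - v) *m A) (p + (y - v) *m A) a01.
  move/(ler_wpM2l k0).
  by move: (h _) => H1; move: (h _) => H2; move: (h _) => H3; nra.
have gNy := proj1 g_proper.
have f_proper : eproper f.
  split=> [z|]; first by rewrite fE; case: (g z) (gNy z).
  have [z gz] := proj2 g_proper; exists z.
  by rewrite /edom/= fE (fine_edom gz) -EFinD ltry.
have f_closed : eclosed f by rewrite fE; exact: eclosedD_continuous.
have f_sc : strongly_econvex s f by rewrite fE; exact: strongly_econvexD.
have zmin : argmin f (argmin_pt f).
  have [z0 z0min] := strongly_econvex_has_argmin s0 f_proper f_closed f_sc.
  by rewrite /argmin_pt; case: xgetP => // /(_ z0).
set z := argmin_pt f in zmin *.
have gz : edom g z.
  have [w gw] := proj2 g_proper.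
  have := zmin w; rewrite fE (fine_edom gw) -EFinD => /le_lt_trans/(_ (ltry _)).
  by rewrite /edom/=; case: (g z) => [b _|//|//]; rewrite ltry.
split=> // w gw; rewrite -lee_fin !EFinD -!fine_edom//.
have := strongly_econvex_growth w s0 f_proper f_sc zmin.
by rewrite fE /q !EFinD.
Qed.

Variables (c : 'rV[R]_d -> 'rV[R]_m) (tau : R).
Hypothesis tau_gt0 : 0 < tau.

Lemma prox_step_min y (x := prox_step g h c (1 / tau) y) :
  edom g x /\ forall w, edom g w ->
    G x + h (c y + (x - y) *m jacobian c y) + tau / 2 * enorm (x - y) ^+ 2 <=
    G w + h (c y + (w - y) *m jacobian c y) + tau / 2 * enorm (w - y) ^+ 2.
Proof.
have [|gx xmin] := @regularized_argmin 1 tau (c y) (jacobian c y) y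
  (prox_model g h c (1 / tau) y) ler01 tau_gt0.
  have e : (2 * (1 / tau))^-1 = tau / 2.
    by field; rewrite gt_eqF.
  by move=> z; rewrite /prox_model e mul1r.
split=> // w /xmin xw; rewrite -/(prox_step _ _ _ _ _) -/x !(mul1r (h _)) !addrA in xw.
by apply: le_trans xw; rewrite lerDl mulr_ge0 ?sqr_ge0 ?divr_ge0 ?ltW.
Qed.

(** The quadratic growth at [u] is kept because it supplies the distance that
    telescopes; multiplying by [a] makes [h] appear with the same weight as in
    the prox-linear model. *)
Lemma acc_step_min a y v (u := acc_step g h c (1 / (tau * a)) a y v) :
  0 < a ->
  edom g u /\ forall w, edom g w ->
    a * G u + h (c y + a *: ((u - v) *m jacobian c y))
      + tau / 2 * a ^+ 2 * (enorm (u - v) ^+ 2 + enorm (w - u) ^+ 2) <=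
    a * G w + h (c y + a *: ((w - v) *m jacobian c y))
      + tau / 2 * a ^+ 2 * enorm (w - v) ^+ 2.
Proof.
move=> a0.
have [|||gu umin] := @regularized_argmin a^-1 (tau * a) (c y)
  (a *: jacobian c y) v (acc_prox_model g h c (1 / (tau * a)) a y v).
- by rewrite invr_ge0 ltW.
- by rewrite mulr_gt0.
- move=> z; rewrite /acc_prox_model /acc_model -addeA -EFinD -scalemxAr.
  by rewrite (_ : (2 * (1 / (tau * a)))^-1 = tau * a / 2)//; field; rewrite !gt_eqF.
rewrite -/(acc_step _ _ _ _ _ _ _) -/u in gu umin; split=> // w /umin.
rewrite -!scalemxAr -(ler_pM2l a0).
rewrite -/(G _); move: (h _) (h _) => h1 h2 H.
have aK t : a * (a^-1 * t) = t by rewrite mulVKf ?gt_eqF.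
move: H; rewrite !mulrDr !aK; lra.
Qed.

End models.

Section descent.
Context {R : realType} {d m : nat}.
Variables (g : 'rV[R]_d -> \bar R) (h : 'rV[R]_m -> R)
  (c : 'rV[R]_d -> 'rV[R]_m) (L beta tau : R).
Hypotheses (g_proper : eproper g) (g_closed : eclosed g) (g_convex : econvex g)
  (h_convex : convex_function [set: 'rV[R]_m] h)
  (L_ge0 : 0 <= L) (h_lip : elipschitz L h)
  (c_diff : forall x, differentiable c x)
  (beta_ge0 : 0 <= beta) (c_lip : lipschitz_jacobian beta c)
  (tau_gt0 : 0 < tau).
Implicit Types (x y z v w : 'rV[R]_d).

(** This is where [mu = L * beta] comes from: the composite exceeds its
    prox-linear model by at most [mu / 2] times the squared distance. *)
Lemma composite_le_linearization y z :
  h (c z) <= h (c y + (z - y) *m jacobian c y)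
             + L * beta / 2 * enorm (z - y) ^+ 2.
Proof.
rewrite -lerBlDl (le_trans (ler_norm _))// (le_trans (h_lip _ _))//.
rewrite -!mulrA ler_wpM2l// mulrA.
exact: linearization_error.
Qed.

(** The point [z] that compares the two subproblems is
    [a *: v1 + (1 - a) *: x0]: its displacement from [y] is
    [a *: (v1 - v0)], so the two models agree there up to the scaling by [a].
    Likewise [a *: xs + (1 - a) *: x0] is displaced from [y] by
    [a *: (xs - v0)], which transports the comparison with [xs]. *)
Lemma accelerated_step (r rho a : R) (x0 v0 xs : 'rV[R]_d)
    (y := a *: v0 + (1 - a) *: x0)
    (x1 := prox_step g h c (1 / tau) y)
    (v1 := acc_step g h c (1 / (tau * a)) a y v0) :
  weakly_convex_on rho (edom g) (h \o c) -> pair_convex_on r (edom g) h c ->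
  0 < a -> a <= 1 -> edom g x0 -> edom g v0 -> edom g xs ->
  fine (g x1) + h (c x1) <=
    a * (fine (g xs) + h (c xs)) + (1 - a) * (fine (g x0) + h (c x0))
    - (tau - L * beta) / 2 * enorm (x1 - y) ^+ 2
    + tau / 2 * a ^+ 2 * (enorm (xs - v0) ^+ 2 - enorm (xs - v1) ^+ 2)
    + r / 2 * a ^+ 2 * enorm (xs - v0) ^+ 2
    + rho * a * (1 - a) * enorm (xs - x0) ^+ 2.
Proof.
move=> rho_wc r_cc a0 a1 gx0 gv0 gxs.
have a01 : 0 <= a <= 1 by rewrite ltW.
have gy : edom g y by exact: edom_conv.
have [gx1 x1min] : edom g x1 /\ _ := prox_step_min g_proper g_closed g_convex
  h_convex L_ge0 h_lip c tau_gt0 y.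
have [gv1 v1min] : edom g v1 /\ _ := acc_step_min g_proper g_closed g_convex
  h_convex L_ge0 h_lip c tau_gt0 y v0 a0.
have shift u : a *: u + (1 - a) *: x0 - y = a *: (u - v0).
  by rewrite /y opprD addrACA subrr addr0 -scalerBr.
pose z := a *: v1 + (1 - a) *: x0.
have gz : edom g z by exact: edom_conv.
have z_lin : (z - y) *m jacobian c y = a *: ((v1 - v0) *m jacobian c y).
  by rewrite shift -scalemxAl.
have z_dist : enorm (z - y) ^+ 2 = a ^+ 2 * enorm (v1 - v0) ^+ 2.
  by rewrite shift enormZ exprMn real_normK ?num_real.
pose u := a *: xs + (1 - a) *: x0.
have gu : edom g u by exact: edom_conv.
have u_lin : (u - y) *m jacobian c y = a *: ((xs - v0) *m jacobian c y).
  by rewrite shift -scalemxAl.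
have u_dist : enorm (u - y) ^+ 2 = a ^+ 2 * enorm (xs - v0) ^+ 2.
  by rewrite shift enormZ exprMn real_normK ?num_real.
have h1 := composite_le_linearization y x1.
have h2 := x1min z gz; rewrite -/x1 z_lin z_dist in h2.
have h3 : fine (g z) <= _ := fine_convex g_proper g_convex a01 gv1 gx0.
have h4 := v1min xs gxs; rewrite -/v1 in h4.
have h5 := r_cc u y gu gy; rewrite u_lin u_dist in h5.
have h6 : h (c u) <= _ := rho_wc xs x0 gxs gx0 a a01.
rewrite /= in h6; lra.
Qed.

End descent.

(** * Summing the one-step inequalities *)

Section telescoping.
Context {R : realType}.

(** Dividing the one-step inequality by [a_k ^+ 2] makes the distance terms
    telescope.  The weights of the values fit together because
    [(1 - a_k) / a_k ^+ 2 = (k ^ 2 - 1) / 4] is at most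
    [1 / a_(k-1) ^+ 2 = k ^ 2 / 4]; as this weight vanishes at [k = 1], the
    initial value [D 0] disappears. *)
Lemma accelerated_telescope (tau kappa r rho B : R) (a D Q E : nat -> R) :
  (forall k, (1 <= k)%N -> a k = 2 / (k%:R + 1)) ->
  (forall k, (1 <= k)%N -> 0 <= D k) ->
  (forall k, (1 <= k)%N ->
    D k <= (1 - a k) * D k.-1 - kappa / 2 * E k
           + tau / 2 * a k ^+ 2 * (Q k.-1 - Q k)
           + B * (r / 2 * a k ^+ 2 + rho * a k * (1 - a k))) ->
  forall N, (1 <= N)%N ->
    D N * (N%:R + 1) ^+ 2 / 4 + tau / 2 * Q N
      + kappa / 2 * \sum_(1 <= k < N.+1) E k * (k%:R + 1) ^+ 2 / 4
    <= tau / 2 * Q 0 + B * (r / 2 * N%:R + rho * N%:R * (N%:R - 1) / 4).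
Proof.
move=> aE D0 step.
have scaled k : (1 <= k)%N -> D k * (k%:R + 1) ^+ 2 / 4 <=
    D k.-1 * ((k%:R - 1) * (k%:R + 1) / 4)
    - kappa / 2 * (E k * (k%:R + 1) ^+ 2 / 4)
    + tau / 2 * (Q k.-1 - Q k) + B * (r / 2 + rho * (k%:R - 1) / 2).
  move=> k1; have := step k k1; rewrite aE//.
  have K0 : 0 < (k%:R + 1 : R) by rewrite ltr_wpDl.
  move: (k%:R : R) K0 => K K0 H.
  have s0 : 0 < (K + 1) ^+ 2 / 4 by rewrite divr_gt0// exprn_gt0.
  move: H; rewrite -(ler_pM2l s0) => H.
  rewrite -mulrA mulrC (le_trans H)// le_eqVlt; apply/orP; left; apply/eqP.
  by field; rewrite gt_eqF.
elim=> // -[_ _|N IH _].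
  have := scaled 1%N isT; rewrite big_nat1 /= subrr !(mul0r, mulr0).
  lra.
have := IH isT; have := scaled N.+2 isT; have := D0 N.+1 isT.
rewrite [in X in _ -> _ -> X](big_nat_recr N.+2)//=.
move: (\sum_(1 <= _ < _) _) => S D0' h1 h2.
have h3 : D N.+1 * ((N.+2%:R - 1) * (N.+2%:R + 1) / 4) <=
    D N.+1 * (N.+1%:R + 1) ^+ 2 / 4.
  rewrite -[leRHS]mulrA ler_wpM2l//.
  by rewrite -(natr1 N.+1); lra.
rewrite -(natr1 N.+1) in h1 h3 *; lra.
Qed.

Lemma sum_succ_sqr_ge N :
  N%:R * (N%:R + 1) * (2 * N%:R + 1) / 6 <=
    \sum_(1 <= k < N.+1) (k%:R + 1 : R) ^+ 2.
Proof.
elim: N => [|N IH]; first by rewrite big_geq// !mul0r.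
rewrite big_nat_recr//=; move: IH; move: (\sum_(_ <= _ < _) _) => S.
rewrite -(natr1 N); have : 0 <= (N%:R : R) by [].
by move: (N%:R : R) => n; lra.
Qed.

Lemma min_from1_le N (f : nat -> R) j : (1 <= j <= N)%N -> min_from1 N f <= f j.
Proof.
move=> /andP[j1 jN]; rewrite /min_from1.
have [->|j2] := eqVneq j 1%N; first exact: bigmin_le_id.
apply: bigmin_inf_seq (lexx _) => //.
by rewrite mem_index_iota ltnS jN andbT ltn_neqAle eq_sym j2.
Qed.

Lemma min_from1_ge N (f : nat -> R) b :
  (forall j, (1 <= j)%N -> b <= f j) -> b <= min_from1 N f.
Proof.
move=> bf; rewrite /min_from1 big_seq_cond; apply: le_bigmin.
  exact: bf.
by move=> i /andP[+ _]; rewrite mem_index_iota => /andP[/ltnW i1 _]; exact: bf.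
Qed.

(** The weights are bounded below by [k ^ 2 / 4], whose sum has the closed form
    on the left. *)
Lemma min_from1_weighted N (f : nat -> R) : (forall j, 0 <= f j) ->
  min_from1 N f * (N%:R * (N%:R + 1) * (2 * N%:R + 1) / 24) <=
    \sum_(1 <= k < N.+1) f k * (k%:R + 1) ^+ 2 / 4.
Proof.
move=> f0; have min0 : 0 <= min_from1 N f by exact: min_from1_ge.
apply: (@le_trans _ _ (\sum_(1 <= k < N.+1) min_from1 N f * ((k%:R + 1) ^+ 2 / 4))).
  rewrite -mulr_sumr ler_wpM2l// -mulr_suml.
  by have := sum_succ_sqr_ge N; lra.
rewrite !big_nat; apply: ler_sum => k kN; by rewrite -mulrA ler_wpM2r ?min_from1_le.
Qed.

End telescoping.

(** * The convergence rates *)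

Section auxiliary.
Context {R : realType}.

(** The linearization of [c] at [p = a *: x + (1 - a) *: y] is affine and takes
    the value [c p] at [p]; so convexity of [h] bounds [h (c p)] by its values
    along the linearization at [x] and [y], and these are at most [h (c x)] and
    [h (c y)].  Hence at [r = 0] the constant [rho = 0] is admissible too. *)
Lemma pair_convex_on0_convex d m (U : set 'rV[R]_d) (h : 'rV[R]_m -> R) c :
  convex_function [set: 'rV[R]_m] h ->
  (forall x y a, 0 <= a <= 1 -> U x -> U y -> U (a *: x + (1 - a) *: y)) ->
  pair_convex_on 0 U h c -> weakly_convex_on 0 U (h \o c).
Proof.
move=> hcvx Ucvx hc x y Ux Uy a a01 /=; rewrite !mul0r addr0.
have /andP[a0 a1] := a01.
set p := a *: x + (1 - a) *: y; have Up : U p by exact: Ucvx.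
have hx := hc x p Ux Up; have hy := hc y p Uy Up.
rewrite !mul0r !addr0 in hx hy.
have comb : a *: (x - p) + (1 - a) *: (y - p) = 0.
  rewrite !scalerBr addrACA -opprD -scalerDl (addrC a) subrK scale1r.
  by rewrite subrr.
have := convex_functionE hcvx (c p + (x - p) *m jacobian c p)
  (c p + (y - p) *m jacobian c p) a01.
have -> : a *: (c p + (x - p) *m jacobian c p)
    + (1 - a) *: (c p + (y - p) *m jacobian c p) = c p.
  rewrite !scalerDr addrACA -scalerDl (addrC a) subrK scale1r.
  by rewrite !scalemxAl -mulmxDl comb mul0mx addr0.
move/le_trans; apply; by apply: lerD; rewrite ler_wpM2l ?subr_ge0.
Qed.

Lemma edom_diam_ge d (g : 'rV[R]_d -> \bar R) x y :
  (edom_diam g < +oo)%E -> edom g x -> edom g y ->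
  enorm (x - y) <= fine (edom_diam g).
Proof.
move=> gfin gx gy; have le_diam : ((enorm (x - y))%:E <= edom_diam g)%E.
  by apply: ereal_sup_ubound; exists x => //; exists y.
rewrite -lee_fin fineK// fin_numE; apply/andP; split; last by rewrite lt_eqF.
by apply: contraTneq le_diam => ->.
Qed.

End auxiliary.

Theorem theorem8p5 (R : realType) (d m : nat)
  (g : 'rV[R]_d -> \bar R) (h : 'rV[R]_m -> R) (c : 'rV[R]_d -> 'rV[R]_m)
  (L beta mu rho r tmu : R)
  (a : nat -> R) (x v y : nat -> 'rV[R]_d) (xs : 'rV[R]_d)
  (g_proper : eproper g) (g_closed : eclosed g) (g_convex : econvex g)
  (h_convex : convex_function [set: 'rV[R]_m] h)
  (L_ge0 : 0 <= L) (h_lip : elipschitz L h)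
  (c_C1 : C1_smooth c)
  (beta_ge0 : 0 <= beta) (c_lip : lipschitz_jacobian beta c)
  (mu_def : mu = L * beta)
  (rho_ge0 : 0 <= rho)
  (rho_wc : weakly_convex_on rho (edom g) (h \o c))
  (r_ge0 : 0 <= r) (r_cc : pair_convex_on r (edom g) h c)
  (tmu_gt : mu < tmu)
  (x0_dom : edom g (x 0%N)) (v0_dom : edom g (v 0%N))
  (a_def : forall k, (1 <= k)%N -> a k = 2 / (k%:R + 1))
  (y_def : forall k, (1 <= k)%N ->
    y k = a k *: v k.-1 + (1 - a k) *: x k.-1)
  (x_def : forall k, (1 <= k)%N -> x k = prox_step g h c (1 / tmu) (y k))
  (v_def : forall k, (1 <= k)%N ->
    v k = acc_step g h c (1 / (tmu * a k)) (a k) (y k) (v k.-1))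
  (xs_le : forall k, (1 <= k)%N -> (Fobj g h c xs <= Fobj g h c (x k))%E) :
  (((edom_diam g < +oo)%E ->
    forall N, (1 <= N)%N ->
      min_from1 N (fun j => enorm (prox_grad g h c (1 / tmu) (y j)) ^+ 2) <=
      24 * tmu ^+ 2 / (tmu - mu) *
      (tmu * enorm (xs - v 0%N) ^+ 2 / (N%:R * (N%:R + 1) * (2 * N%:R + 1)) +
       fine (edom_diam g) ^+ 2 * (r + rho / 2 * (N%:R + 3)) /
         ((N%:R + 1) * (2 * N%:R + 1))))
  /\
   (r = 0 ->
    forall N, (1 <= N)%N ->
      min_from1 N (fun j => enorm (prox_grad g h c (1 / tmu) (y j)) ^+ 2) <=
      24 * tmu ^+ 2 / (tmu - mu) *
      (tmu * enorm (xs - v 0%N) ^+ 2 / (N%:R * (N%:R + 1) * (2 * N%:R + 1)))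
      /\
      (Fobj g h c (x N) - Fobj g h c xs <=
        (2 * tmu * enorm (xs - v 0%N) ^+ 2 / (N%:R + 1) ^+ 2)%R%:E)%E)).
Proof.
have c_diff := proj1 c_C1.
have mu_ge0 : 0 <= mu by rewrite mu_def mulr_ge0.
have tmu_gt0 : 0 < tmu by exact: le_lt_trans tmu_gt.
have a_bnd k : (1 <= k)%N -> 0 < a k <= 1.
  move=> k1; rewrite a_def// divr_gt0 ?ltr_wpDl//= ler_pdivrMr ?ltr_wpDl//.
  by rewrite mul1r -[2]/(1 + 1) lerD2r ler1n.
have x_dom k : edom g (x k).
  case: k => // k; rewrite x_def//.
  exact: (prox_step_min g_proper g_closed g_convex h_convex L_ge0 h_lip c
    tmu_gt0 _).1.
have v_dom k : edom g (v k).
  case: k => // k; rewrite v_def//; have /andP[ak _] := a_bnd k.+1 isT.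
  exact: (acc_step_min g_proper g_closed g_convex h_convex L_ge0 h_lip c
    tmu_gt0 _ _ ak).1.
pose F w := fine (g w) + h (c w).
have F_fin w : edom g w -> Fobj g h c w = (F w)%:E.
  by move=> gw; rewrite /Fobj (fine_edom g_proper gw).
have xs_dom : edom g xs.
  have := @xs_le 1%N isT.
  rewrite (F_fin (x 1%N))// /Fobj /edom/= => /le_lt_trans/(_ (ltry _)).
  by case: (g xs) => [b _|//|//]; rewrite ltry.
pose D k := F (x k) - F xs.
have D_ge0 k : (1 <= k)%N -> 0 <= D k.
  by move=> k1; rewrite subr_ge0 -lee_fin -!F_fin//; exact: xs_le.
pose G k := enorm (prox_grad g h c (1 / tmu) (y k)) ^+ 2.
have GE k : (1 <= k)%N -> G k = tmu ^+ 2 * enorm (x k - y k) ^+ 2.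
  move=> k1; rewrite /G /prox_grad -x_def// enormZ exprMn real_normK ?num_real//.
  by rewrite enorm_distC div1r invrK.
(* [B] is the squared diameter if that is finite, and [0] if [r' = rho' = 0]. *)
have telescope r' rho' B : weakly_convex_on rho' (edom g) (h \o c) ->
    pair_convex_on r' (edom g) h c -> 0 <= rho' ->
    (forall k, r' * enorm (xs - v k) ^+ 2 <= B * r') ->
    (forall k, rho' * enorm (xs - x k) ^+ 2 <= B * rho') ->
    forall N, (1 <= N)%N ->
    D N * (N%:R + 1) ^+ 2 / 4 + tmu / 2 * enorm (xs - v N) ^+ 2
      + (tmu - mu) / 2
        * \sum_(1 <= k < N.+1) enorm (x k - y k) ^+ 2 * (k%:R + 1) ^+ 2 / 4
    <= tmu / 2 * enorm (xs - v 0%N) ^+ 2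
       + B * (r' / 2 * N%:R + rho' * N%:R * (N%:R - 1) / 4).
  move=> wc cc rho0 Bv Bx.
  apply: (accelerated_telescope (Q := fun k => enorm (xs - v k) ^+ 2) a_def D_ge0).
  move=> k k1; have /andP[ak0 ak1] := a_bnd k k1.
  have := accelerated_step g_proper g_closed g_convex h_convex L_ge0 h_lip
    c_diff beta_ge0 c_lip tmu_gt0 wc cc ak0 ak1 (x_dom k.-1) (v_dom k.-1) xs_dom.
  rewrite -y_def// -x_def// -v_def// -mu_def -!/(F _) /D.
  have := ler_wpM2l (sqr_ge0 (a k)) (Bv k.-1).
  have aa : 0 <= a k * (1 - a k) by rewrite mulr_ge0 ?subr_ge0// ltW.
  have := ler_wpM2l aa (Bx k.-1).
  lra.
have rate r' rho' B N : (1 <= N)%N -> 0 <= rho' -> 0 <= B ->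
    D N * (N%:R + 1) ^+ 2 / 4 + tmu / 2 * enorm (xs - v N) ^+ 2
      + (tmu - mu) / 2
        * \sum_(1 <= k < N.+1) enorm (x k - y k) ^+ 2 * (k%:R + 1) ^+ 2 / 4
    <= tmu / 2 * enorm (xs - v 0%N) ^+ 2
       + B * (r' / 2 * N%:R + rho' * N%:R * (N%:R - 1) / 4) ->
    min_from1 N G <= 24 * tmu ^+ 2 / (tmu - mu) *
      (tmu * enorm (xs - v 0%N) ^+ 2 / (N%:R * (N%:R + 1) * (2 * N%:R + 1))
       + B * (r' + rho' / 2 * (N%:R + 3)) / ((N%:R + 1) * (2 * N%:R + 1))).
  move=> N1 rho0 B0 T.
  have kap : 0 < tmu - mu by rewrite subr_gt0.
  have Np : 0 < (N%:R : R) by rewrite ltr0n.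
  have := @min_from1_weighted R N G (fun j => sqr_ge0 _).
  have -> : \sum_(1 <= k < N.+1) G k * (k%:R + 1) ^+ 2 / 4 = tmu ^+ 2 *
      \sum_(1 <= k < N.+1) enorm (x k - y k) ^+ 2 * (k%:R + 1) ^+ 2 / 4.
    rewrite mulr_sumr; apply: eq_big_nat => k /andP[k1 _].
    by rewrite GE// !mulrA.
  move: T; move: (\sum_(_ <= _ < _) _) => S T mS.
  have := D_ge0 N N1; move: (D N) T => DN T DN0.
  have Q0 := sqr_ge0 (enorm (xs - v N)).
  move: (enorm (xs - v N) ^+ 2) Q0 T => Q Q0 T.
  move: (enorm (xs - v 0%N) ^+ 2) T => q T.
  move: (min_from1 N G) mS => mn mS.
  move: (N%:R : R) Np mS T => n n0 mS T.
  (* Here [n - 1] is relaxed to [n + 3]. *)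
  have T1 : (tmu - mu) / 2 * S <= tmu / 2 * q + B * (n / 2 * (r' + rho' / 2 * (n + 3))).
    have h1 : 0 <= DN * (n + 1) ^+ 2 / 4 by rewrite divr_ge0// mulr_ge0// sqr_ge0.
    have h2 : 0 <= tmu / 2 * Q by rewrite mulr_ge0// divr_ge0// ltW.
    have h3 : 0 <= B * (rho' * n) by rewrite !mulr_ge0// ltW.
    lra.
  pose W := (tmu - mu) / 2 * (n * (n + 1) * (2 * n + 1) / 24).
  have n1 : 0 < n + 1 by lra.
  have n2 : 0 < 2 * n + 1 by lra.
  have W0 : 0 < W by rewrite mulr_gt0 ?divr_gt0 ?mulr_gt0.
  rewrite -(ler_pM2r W0).
  apply: (@le_trans _ _ (tmu ^+ 2 * ((tmu - mu) / 2 * S))).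
    rewrite /W mulrCA [leRHS]mulrCA ler_wpM2l//.
    by rewrite divr_ge0 ?ltW.
  apply: (le_trans (ler_wpM2l (sqr_ge0 tmu) T1)).
  rewrite le_eqVlt; apply/orP; left; apply/eqP; rewrite /W.
  by field; rewrite !gt_eqF.
split=> [diam_fin N N1|r0 N N1].
  pose M := fine (edom_diam g).
  have sqr_le w : edom g w -> enorm (xs - w) ^+ 2 <= M ^+ 2.
    move=> gw; have := edom_diam_ge diam_fin xs_dom gw.
    by move=> h1; rewrite ler_pXn2r ?nnegrE ?enorm_ge0// (le_trans (enorm_ge0 _) h1).
  apply: rate; rewrite ?sqr_ge0//; apply: telescope => // k;
    by rewrite mulrC ler_wpM2r// sqr_le.
rewrite r0 in r_cc.
have wc0 : weakly_convex_on 0 (edom g) (h \o c).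
  by apply: pair_convex_on0_convex => // *; exact: edom_conv.
have zero0 (b : R) : 0 * b <= 0 * 0 by rewrite !mul0r.
have T := telescope _ _ 0 wc0 r_cc (lexx 0) (fun k => zero0 _)
  (fun k => zero0 _) N N1.
split.
  have := rate _ _ _ _ N1 (lexx 0) (lexx 0) T.
  by rewrite !mul0r addr0.
rewrite !F_fin// -EFinB lee_fin -/(D N).
have n1 : 0 < (N%:R + 1 : R) by rewrite ltr_wpDl.
rewrite ler_pdivlMr ?exprn_gt0//.
have h2 : 0 <= tmu / 2 * enorm (xs - v N) ^+ 2.
  by rewrite mulr_ge0 ?sqr_ge0// divr_ge0// ltW.
have h3 : 0 <= (tmu - mu) / 2
    * \sum_(1 <= k < N.+1) enorm (x k - y k) ^+ 2 * (k%:R + 1) ^+ 2 / 4.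
  apply: mulr_ge0; first by rewrite divr_ge0// subr_ge0 ltW.
  apply: sumr_ge0 => k _.
  by rewrite divr_ge0// mulr_ge0// sqr_ge0.
lra.
Qed.
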